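(* Let $\varphi\equiv\forall n\,P(n)$ be a $\Pi^0_1$ sentence, with $P$ a primitive recursive predicate. If $\varphi$ is true in $\mathbb{N}$, then $\mathsf{BH\text{-}struct}(\varphi)$ holds; that is, for every model $M$, if $M\models\mathrm{ZFC}+\neg\varphi$, then $\omega^M\neq\omega$.
   Context: For a sentence $\varphi$, the predicate $\mathsf{BH\text{-}struct}(\varphi)$ is defined by $$\mathsf{BH\text{-}struct}(\varphi)\iff\forall M\,\bigl(M\models\mathrm{ZFC}+\neg\varphi\ \Rightarrow\ \omega^M\neq\omega\bigr).$$ Here $\omega^M$ is the set of natural numbers in the sense of the model $M$ of $\mathrm{ZFC}$, and its standard part is identified with $\omega$, so $\omega^M=\omega$ means that $M$ is $\omega$-standard (it has no nonstandard natural numbers) and $\omega^M\neq\omega$ means that $M$ has nonstandard natural numbers. An arithmetical sentence $\varphi$ is interpreted in a model of $\mathrm{ZFC}$ through the usual translation into set theory, with number quantifiers ranging over $\omega$ and primitive recursive predicates given by their standard definitions. *)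

(* Defs.v *)
From mathcomp Require Import all_boot.

Set Implicit Arguments.
Unset Strict Implicit.
Unset Printing Implicit Defensive.

(* Well-scoped de Bruijn variables: [var n] has exactly n elements, and    *)
(* doubles as the index type of n-tuples, represented as [var n -> T].     *)

Fixpoint var (n : nat) : Set := if n is m.+1 then option (var m) else void.

Definition env0 (T : Type) : var 0 -> T := of_void T.

Definition vz {n : nat} : var n.+1 := None.
Definition vs {n : nat} (x : var n) : var n.+1 := Some x.

Notation v0 := vz.
Notation v1 := (vs v0).
Notation v2 := (vs v1).
Notation v3 := (vs v2).

Definition scons {T : Type} {n : nat} (d : T) (r : var n -> T) :
    var n.+1 -> T :=
  fun x => if x is Some y then r y else d.

(* The variables of a context of size n extended by m variables.           *)

Fixpoint newv {m n : nat} : var m -> var (m + n) :=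
  if m is m'.+1 return var m -> var (m + n)
  then fun x => if x is Some y then vs (newv y) else vz
  else fun x => match x with end.

Fixpoint oldv {m n : nat} (x : var n) : var (m + n) :=
  if m is m'.+1 return var (m + n) then vs (oldv x) else x.

(* First-order formulas of the language {\in, =}, with n free variables.   *)

Inductive form (n : nat) : Type :=
| FMem (x y : var n)
| FEq (x y : var n)
| FBot
| FImp (A B : form n)
| FAnd (A B : form n)
| FOr (A B : form n)
| FAll (A : form n.+1)
| FEx (A : form n.+1).

Definition sentence : Type := form 0.

Declare Scope fol_scope.
Delimit Scope fol_scope with fol.
Bind Scope fol_scope with form.
Arguments FBot {n}.
Arguments FAll {n} A%_fol.
Arguments FEx {n} A%_fol.

Notation "x \in y" := (FMem x y) : fol_scope.
Notation "x = y" := (FEq x y) : fol_scope.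
Notation "A -> B" := (FImp A B) : fol_scope.
Notation "A /\ B" := (FAnd A B) : fol_scope.
Notation "A \/ B" := (FOr A B) : fol_scope.
Notation "~ A" := (FImp A FBot) : fol_scope.
Notation "A <-> B" := (FAnd (FImp A B) (FImp B A)) : fol_scope.

Record structure : Type := Structure {
  carrier :> Type;
  mem_rel : carrier -> carrier -> Prop }.

Fixpoint sat (M : structure) (n : nat) (A : form n) (r : var n -> M) : Prop :=
  match A with
  | FMem x y => mem_rel (r x) (r y)
  | FEq x y => r x = r y
  | FBot => False
  | FImp A B => sat A r -> sat B r
  | FAnd A B => sat A r /\ sat B r
  | FOr A B => sat A r \/ sat B r
  | FAll A => forall d : M, sat A (scons d r)
  | FEx A => exists d : M, sat A (scons d r)
  end.

Definition models (M : structure) (A : sentence) : Prop := sat A (env0 M).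

Definition models_theory (M : structure) (T : sentence -> Prop) : Prop :=
  forall A, T A -> models M A.

Fixpoint ren (m n : nat) (f : var m -> var n) (A : form m) : form n :=
  match A with
  | FMem x y => FMem (f x) (f y)
  | FEq x y => FEq (f x) (f y)
  | FBot => FBot
  | FImp A B => FImp (ren f A) (ren f B)
  | FAnd A B => FAnd (ren f A) (ren f B)
  | FOr A B => FOr (ren f A) (ren f B)
  | FAll A => FAll (ren (scons vz (fun x => vs (f x))) A)
  | FEx A => FEx (ren (scons vz (fun x => vs (f x))) A)
  end.

Fixpoint closure (n : nat) : form n -> sentence :=
  if n is m.+1 return form n -> sentence
  then fun A => closure (FAll A) else fun A => A.

Fixpoint exs (m n : nat) : form (m + n) -> form n :=
  if m is m'.+1 return form (m + n) -> form n
  then fun A => exs (FEx A : form (m' + n)) else fun A => A.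

Fixpoint bigand (m n : nat) : (var m -> form n) -> form n :=
  if m is m'.+1 return (var m -> form n) -> form n
  then fun A => FAnd (A vz) (bigand (fun i => A (vs i)))
  else fun _ => FImp FBot FBot.

Section Abbreviations.
Variable n : nat.
Implicit Types x y z p s w : var n.
Local Open Scope fol_scope.

Definition subset_f x y : form n := FAll (v0 \in vs x -> v0 \in vs y).

Definition empty_f x : form n := ~ FEx (v0 \in vs x).

(* y is the union of x and {x} *)
Definition succ_f x y : form n :=
  FAll (v0 \in vs y <-> (v0 \in vs x \/ v0 = vs x)).

(* p is {x, y} *)
Definition upair_f x y p : form n :=
  FAll (v0 \in vs p <-> (v0 = vs x \/ v0 = vs y)).

End Abbreviations.

(* p is the Kuratowski pair {{x}, {x, y}} *)
Definition opair_f n (x y p : var n) : form n :=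
  FEx (FEx (upair_f (vs (vs x)) (vs (vs x)) v1
            /\ upair_f (vs (vs x)) (vs (vs y)) v0
            /\ upair_f v1 v0 (vs (vs p)))).

(* s contains the pair (x, y) *)
Definition app_f n (s x y : var n) : form n :=
  FEx (opair_f (vs x) (vs y) v0 /\ v0 \in vs s).

Definition function_f n (s : var n) : form n :=
  (FAll (v0 \in vs s -> FEx (FEx (opair_f v1 v0 v2)))
   /\ FAll (FAll (FAll (app_f (vs (vs (vs s))) v2 v1
                        /\ app_f (vs (vs (vs s))) v2 v0 -> v1 = v0))))%fol.

Definition inductive_f n (w : var n) : form n :=
  (FEx (empty_f v0 /\ v0 \in vs w)
   /\ FAll (v0 \in vs w -> FEx (succ_f v1 v0 /\ v0 \in vs (vs w))))%fol.

Definition omega_f n (w : var n) : form n :=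
  (inductive_f w /\ FAll (inductive_f v0 -> subset_f (vs w) v0))%fol.

Definition in_omega_f n (x : var n) : form n :=
  FEx (omega_f v0 /\ vs x \in v0).

Fixpoint numeral_f (k n : nat) (x : var n) : form n :=
  if k is k'.+1 then FEx (numeral_f k' v0 /\ succ_f v0 (vs x)) else empty_f x.

Definition ax_extensionality : sentence :=
  FAll (FAll (FAll (v0 \in v2 <-> v0 \in v1) -> v1 = v0)).

Definition ax_foundation : sentence :=
  FAll (FEx (v0 \in v1) ->
        FEx (v0 \in v1 /\ ~ FEx (v0 \in v2 /\ v0 \in v1))).

Definition ax_pairing : sentence := FAll (FAll (FEx (upair_f v2 v1 v0))).

Definition ax_union : sentence :=
  FAll (FEx (FAll (v0 \in v1 <-> FEx (v0 \in v3 /\ v1 \in v0)))).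

Definition ax_powerset : sentence :=
  FAll (FEx (FAll (v0 \in v1 <-> subset_f v0 v2))).

Definition ax_infinity : sentence := FEx (inductive_f v0).

(* A z p : for all x there is y = { z \in x | A z p } *)
Definition ax_separation (n : nat) (A : form n.+1) : sentence :=
  closure (FAll (FEx (FAll
    (v0 \in v1 <->
     (v0 \in v2 /\ ren (scons v0 (fun p => vs (vs (vs p)))) A))))).

(* A x y p : if A is functional in x, then every set a has an image
   b = { y | exists x \in a, A x y p } *)
Definition ax_replacement (n : nat) (A : form n.+2) : sentence :=
  closure
    (FAll (FAll (FAll
       (ren (scons v2 (scons v1 (fun p => vs (vs (vs p))))) A
        /\ ren (scons v2 (scons v0 (fun p => vs (vs (vs p))))) A
        -> v1 = v0)))
     -> FAll (FEx (FAll
          (v0 \in v1 <->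
           FEx (v0 \in v3
                /\ ren (scons v0 (scons v1 (fun p => vs (vs (vs (vs p)))))) A))))
    )%fol.

(* Every set of nonempty pairwise disjoint sets has a transversal.         *)
Definition ax_choice : sentence :=
  FAll (FAll (v0 \in v1 -> FEx (v0 \in v1))
        /\ FAll (FAll (v1 \in v2 /\ v0 \in v2
                       -> FEx (v0 \in v2 /\ v0 \in v1) -> v1 = v0))
        -> FEx (FAll (v0 \in v2 ->
             FEx (FAll ((v0 \in v2 /\ v0 \in v3) <-> v0 = v1))))).

Inductive ZFC : sentence -> Prop :=
| ZFC_extensionality : ZFC ax_extensionality
| ZFC_foundation : ZFC ax_foundation
| ZFC_pairing : ZFC ax_pairing
| ZFC_union : ZFC ax_union
| ZFC_powerset : ZFC ax_powerset
| ZFC_infinity : ZFC ax_infinity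
| ZFC_separation n (A : form n.+1) : ZFC (ax_separation A)
| ZFC_replacement n (A : form n.+2) : ZFC (ax_replacement A)
| ZFC_choice : ZFC ax_choice.

(* Definitions of primitive recursive functions. [PRec g h] is given by    *)
(*   f(0, v) = g(v),  f(i + 1, v) = h(i, f(i, v), v).                      *)

Inductive primrec : nat -> Type :=
| PZero k : primrec k
| PSucc : primrec 1
| PProj k (i : var k) : primrec k
| PComp k m (h : primrec m) (g : var m -> primrec k) : primrec k
| PRec k (g : primrec k) (h : primrec k.+2) : primrec k.+1.

Fixpoint eval (k : nat) (f : primrec k) : (var k -> nat) -> nat :=
  match f in primrec k return (var k -> nat) -> nat with
  | PZero _ => fun _ => 0
  | PSucc => fun v => (v vz).+1
  | PProj _ i => fun v => v i
  | PComp _ _ h g => fun v => eval h (fun i => eval (g i) v)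
  | PRec _ g h => fun v =>
      let v' := fun i => v (vs i) in
      (fix r (a : nat) : nat :=
         if a is i.+1 then eval h (scons i (scons (r i) v')) else eval g v')
        (v vz)
  end.

(* A primitive recursive predicate is given by its characteristic function. *)
Record primrec_pred (k : nat) : Type := PrimrecPred {
  char_fun : primrec k;
  char_fun_le1 : forall v : var k -> nat, eval char_fun v <= 1 }.

Definition holds (k : nat) (P : primrec_pred k) (v : var k -> nat) : Prop :=
  eval (char_fun P) v = 1.

(* [graph_f f x y] says f(x) = y. For PRec, y is the value at a = x vz of  *)
(* a function s with domain a + 1 satisfying the recursion equations.      *)

Fixpoint graph_f (k : nat) (f : primrec k) :
    forall n : nat, (var k -> var n) -> var n -> form n :=
  match f in primrec k
        return forall n : nat, (var k -> var n) -> var n -> form n with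
  | PZero _ => fun n x y => empty_f y
  | PSucc => fun n x y => succ_f (x vz) y
  | PProj _ i => fun n x y => FEq y (x i)
  | PComp _ m h g => fun n x y =>
      exs (FAnd
        (bigand (fun i : var m =>
           graph_f (g i) (fun j => oldv (x j)) (newv i : var (m + n))))
        (graph_f h (fun i => newv i) (oldv y : var (m + n))))
  | PRec _ g h => fun n x y =>
      let a := x vz in
      let p := fun i => x (vs i) in
      FEx (function_f v0
        /\ FAll (FEx (app_f v2 v1 v0)
                 <-> (v0 \in vs (vs a) \/ v0 = vs (vs a)))
        /\ FEx (FEx (empty_f v1
             /\ graph_f g (fun i => vs (vs (vs (p i)))) v0
             /\ app_f v2 v1 v0))
        /\ FAll (v0 \in vs (vs a) ->
             FEx (FEx (FEx (succ_f v3 v2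
               /\ app_f (vs v3) v3 v1
               /\ app_f (vs v3) v2 v0
               /\ graph_f h
                    (scons v3
                      (scons v1 (fun i => vs (vs (vs (vs (vs (p i))))))))
                    v0))))
        /\ app_f v0 (vs a) (vs y))
  end.

(* Arithmetical formulas. Addition, multiplication, equality and order need *)
(* no separate symbols: their graphs are primitive recursive predicates.    *)

Inductive aform (n : nat) : Type :=
| APred k (P : primrec_pred k) (x : var k -> var n)
| ABot
| AImp (A B : aform n)
| AAnd (A B : aform n)
| AOr (A B : aform n)
| AAll (A : aform n.+1)
| AEx (A : aform n.+1).

Fixpoint asat (n : nat) (A : aform n) (r : var n -> nat) : Prop :=
  match A with
  | APred _ P x => holds P (fun i => r (x i))
  | ABot => False
  | AImp A B => asat A r -> asat B r
  | AAnd A B => asat A r /\ asat B r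
  | AOr A B => asat A r \/ asat B r
  | AAll A => forall a : nat, asat A (scons a r)
  | AEx A => exists a : nat, asat A (scons a r)
  end.

Definition true_in_N (A : aform 0) : Prop := asat A (env0 nat).

Fixpoint translate (n : nat) (A : aform n) : form n :=
  match A with
  | APred _ P x =>
      FEx (graph_f (char_fun P) (fun i => vs (x i)) v0 /\ numeral_f 1 v0)
  | ABot => FBot
  | AImp A B => FImp (translate A) (translate B)
  | AAnd A B => FAnd (translate A) (translate B)
  | AOr A B => FOr (translate A) (translate B)
  | AAll A => FAll (in_omega_f v0 -> translate A)
  | AEx A => FEx (in_omega_f v0 /\ translate A)
  end.

Definition Pi01 (P : primrec_pred 1) : aform 0 := AAll (APred P id).

Definition omega (M : structure) (x : M) : Prop :=
  sat (in_omega_f v0) (scons x (env0 M)).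

(* The copy of the true natural numbers in M.                              *)
Definition standard (M : structure) (x : M) : Prop :=
  exists k : nat, sat (numeral_f k v0) (scons x (env0 M)).

Definition omega_standard (M : structure) : Prop :=
  forall x : M, omega x <-> standard x.

Definition BH_struct (A : sentence) : Prop :=
  forall M : structure,
    models_theory M ZFC -> models M (~ A)%fol -> ~ omega_standard M.

(* Main.v *)
Require Import Defs.
From mathcomp Require Import all_boot.

Set Implicit Arguments.
Unset Strict Implicit.
Unset Printing Implicit Defensive.

(** A counterexample to [forall n, P n] in an omega-standard model [M] would be
    an element of [M]'s omega, hence the [M]-numeral of a true natural number
    [k], and [P k] is true.  So the whole content is that a true primitive
    recursive equation [f v = y] remains true in [M] of the corresponding
    numerals ([sat_graph]): computations are finite objects, and [M] contains
    every finite object that is described from the outside.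

    The proof is by induction on the definition of [f].  The formula
    [graph_f f] is existential in the computation it speaks of, so witnesses
    suffice, and nothing has to be proved about the other elements that [M]
    may take for computations.  Composition asks for the intermediate values,
    which are numerals.  Primitive recursion asks for the finite sequence of
    values as a set of pairs; it is built in [M] by an external induction that
    adjoins one pair at a time ([finite_sequence_exists]), with pairing and
    union.  That this set is a function in [M] rests on the
    injectivity of Kuratowski pairs and of numerals; the latter comes from
    foundation, since [x = y] for numerals of [i < j] would give [x \in x]. *)

(** * Satisfaction of iterated connectives *)

(** The environment under the block of quantifiers [exs]; it is defined by the
    same recursion as [exs], so that peeling off a quantifier is a
    conversion. *)
Fixpoint catenv (T : Type) (m n : nat) :
    (var m -> T) -> (var n -> T) -> var (m + n) -> T :=
  if m is m'.+1 return (var m -> T) -> (var n -> T) -> var (m + n) -> T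
  then fun d r => scons (d vz) (catenv (fun i => d (vs i)) r)
  else fun _ r => r.

Lemma catenv_newv (T : Type) m n (d : var m -> T) (r : var n -> T) i :
  catenv d r (newv i) = d i.
Proof. by elim: m d i => [d []|m IH d [i|]] //=; rewrite IH. Qed.

Lemma catenv_oldv (T : Type) m n (d : var m -> T) (r : var n -> T) i :
  catenv d r (oldv i) = r i.
Proof. by elim: m d => [|m IH] d //=; rewrite IH. Qed.

Lemma sat_exs (M : structure) m n (A : form (m + n)) (d : var m -> M) r :
  sat A (catenv d r) -> sat (exs A) r.
Proof.
elim: m A d => [|m IH] A d //= HA.
by apply: (IH _ (fun i => d (vs i))); exists (d vz).
Qed.

Lemma sat_bigand (M : structure) m n (A : var m -> form n) (r : var n -> M) :
  (forall i, sat (A i) r) -> sat (bigand A) r.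
Proof. by elim: m A => [|m IH] A HA //=; split=> //; apply: IH. Qed.

(** Selects the intermediate values of a composition all at once. *)
Lemma var_choice (T : Type) m (Q : var m -> T -> Prop) :
  (forall i, exists x, Q i x) -> exists d, forall i, Q i (d i).
Proof.
elim: m Q => [|m IH] Q HQ; first by exists (env0 T); case.
have [x Qx] := HQ vz.
have [d Qd] := IH (fun i => Q (vs i)) (fun i => HQ (vs i)).
by exists (scons x d) => -[i|] /=; [apply: Qd|apply: Qx].
Qed.

(** * Finite sets in a model of ZFC *)

(** The next predicates are the truth conditions of the formulas of the same
    names, with which they are convertible. *)
Section Predicates.
Variable M : structure.
Implicit Types x y z p s : M.

Definition is_empty x := ~ exists z, mem_rel z x.
Definition is_succ x y := forall z, mem_rel z y <-> mem_rel z x \/ z = x.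
Definition is_upair x y p := forall z, mem_rel z p <-> z = x \/ z = y.
Definition is_opair x y p :=
  exists u w, is_upair x x u /\ is_upair x y w /\ is_upair u w p.

Fixpoint is_numeral (k : nat) x : Prop :=
  if k is k'.+1 then exists y, is_numeral k' y /\ is_succ y x else is_empty x.

Lemma sat_numeral k n (x : var n) (r : var n -> M) :
  sat (numeral_f k x) r <-> is_numeral k (r x).
Proof.
elim: k n x r => [|k IH] n x r //=.
split=> -[y [Hy Hs]]; exists y; split; try exact: Hs.
  exact: (proj1 (IH _ v0 (scons y r))).
exact: (proj2 (IH _ v0 (scons y r))).
Qed.

End Predicates.

Section Model.
Variables (M : structure) (M_ZFC : models_theory M ZFC).
Implicit Types x y z p s : M.

Lemma set_ext x y : (forall z, mem_rel z x <-> mem_rel z y) -> x = y.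
Proof. exact: (M_ZFC ZFC_extensionality). Qed.

Lemma upair_exists x y : exists p, is_upair x y p.
Proof. exact: (M_ZFC ZFC_pairing). Qed.

Lemma empty_exists : exists x, is_empty x.
Proof. by have [w [[x [Hx _]] _]] := M_ZFC ZFC_infinity; exists x. Qed.

(** Foundation applied to the singleton of [x]. *)
Lemma mem_irrefl x : ~ mem_rel x x.
Proof.
move=> xx; have [p Hp] := upair_exists x x.
have [|z [/Hp zx disj]] := (M_ZFC ZFC_foundation : models _ _) p.
  by exists x; apply/Hp; left.
have {zx} zx : z = x by case: zx.
by apply: disj; exists x; rewrite zx; split=> //; apply/Hp; left.
Qed.

(** Pairing and union: [s] with [p] adjoined is the union of [{s, {p}}]. *)
Lemma adjoin_exists s p :
  exists t, forall z, mem_rel z t <-> mem_rel z s \/ z = p.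
Proof.
have [q Hq] := upair_exists p p; have [w Hw] := upair_exists s q.
have [t Ht] := M_ZFC ZFC_union w; exists t => z; split.
  case/(Ht z) => y [/Hw [->|->] zy]; first by left.
  by right; case: (proj1 (Hq z) zy).
case=> [zs|->]; apply/(Ht _).
- by exists s; split=> //; apply/Hw; left.
- by exists q; split; [apply/Hw; right|apply/Hq; left].
Qed.

Lemma upair_uniq x y p q : is_upair x y p -> is_upair x y q -> p = q.
Proof. by move=> Hp Hq; apply: set_ext => z; apply: iff_trans (Hp z) (iff_sym (Hq z)). Qed.

Lemma opair_exists x y : exists p, is_opair x y p.
Proof.
have [u Hu] := upair_exists x x; have [w Hw] := upair_exists x y.
by have [p Hp] := upair_exists u w; exists p, u, w.
Qed.

Lemma opair_uniq x y p q : is_opair x y p -> is_opair x y q -> p = q.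
Proof.
move=> [u [w [Hu [Hw Hp]]]] [u' [w' [Hu' [Hw' Hq]]]].
apply: (upair_uniq Hp).
by rewrite (upair_uniq Hu Hu') (upair_uniq Hw Hw').
Qed.

Lemma upair_inj x y x' y' p : is_upair x y p -> is_upair x' y' p ->
  (x = x' /\ y = y') \/ (x = y' /\ y = x').
Proof.
move=> Hp Hp'.
have Hx : x = x' \/ x = y' by apply/Hp'/Hp; left.
have Hy : y = x' \/ y = y' by apply/Hp'/Hp; right.
have Hx' : x' = x \/ x' = y by apply/Hp/Hp'; left.
have Hy' : y' = x \/ y' = y by apply/Hp/Hp'; right.
by case: Hx Hy Hx' Hy' => -> [] -> [] ? [] ?; subst; auto.
Qed.

Lemma opair_inj x y x' y' p :
  is_opair x y p -> is_opair x' y' p -> x = x' /\ y = y'.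
Proof.
move=> [u [w [Hu [Hw Hp]]]] [u' [w' [Hu' [Hw' Hp']]]].
have [] := upair_inj Hp Hp' => -[eu ew]; subst u' w'.
  have xx' : x = x' by have [[]|[]] := upair_inj Hu Hu'.
  subst x'; split=> //.
  by have [[_]|[e1 e2]] := upair_inj Hw Hw' => //; rewrite e2.
have [[e1 e2]|[e1 e2]] := upair_inj Hu Hw';
  have [[e3 e4]|[e3 e4]] := upair_inj Hw Hu'; by subst.
Qed.

(** * Numerals and finite sequences in the model *)

Lemma numeral_exists k : exists x, is_numeral k x.
Proof.
elim: k => [|k [x Hx]]; first exact: empty_exists.
by have [y Hy] := adjoin_exists x x; exists y, x.
Qed.

Lemma numeral_uniq k x y : is_numeral k x -> is_numeral k y -> x = y.
Proof.
elim: k x y => [|k IH] x y.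
  by move=> Hx Hy; apply: set_ext => z; split=> Hz;
    [case: Hx|case: Hy]; exists z.
move=> [x' [Hx Sx]] [y' [Hy Sy]]; have e := IH _ _ Hx Hy; subst y'.
by apply: set_ext => z; apply: iff_trans (Sx z) (iff_sym (Sy z)).
Qed.

Lemma mem_numeral k x : is_numeral k x ->
  forall z, mem_rel z x <-> exists2 i, i < k & is_numeral i z.
Proof.
elim: k x => [|k IH] x.
  by move=> Hx z; split=> [zx|[]//]; case: Hx; exists z.
move=> [y [Hy Sy]] z; apply: (iff_trans (Sy z)); split.
  by case=> [/(IH _ Hy) [i ik Hi]|->]; [exists i => //; apply: ltnW|exists k].
case=> i; rewrite ltnS leq_eqVlt => /orP [/eqP -> Hz|ik Hz].
  by right; apply: numeral_uniq Hz Hy.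
by left; apply/(IH _ Hy); exists i.
Qed.

Lemma numeral_inj i j x : is_numeral i x -> is_numeral j x -> i = j.
Proof.
by move=> Hi Hj; case: (ltngtP i j) => // lt; case: (@mem_irrefl x);
  [apply/(mem_numeral Hj); exists i|apply/(mem_numeral Hi); exists j].
Qed.

Lemma succ_numeral i x y : is_numeral i x -> is_numeral i.+1 y -> is_succ x y.
Proof.
by move=> Hx [x' [Hx' Sx]]; rewrite (numeral_uniq Hx Hx').
Qed.

Definition is_sequence (F : nat -> nat) (k : nat) s :=
  forall p, mem_rel p s <->
    exists i x y, [/\ i < k, is_numeral i x, is_numeral (F i) y
                    & is_opair x y p].

(** The induction is external: [F] is an arbitrary sequence of true naturals,
    with no definition in the model. *)
Lemma finite_sequence_exists F k : exists s, is_sequence F k s.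
Proof.
elim: k => [|k [s Hs]].
  have [s Hs] := empty_exists; exists s => p; split=> [ps|[i [x [y []]]] //].
  by case: Hs; exists p.
have [x Hx] := numeral_exists k; have [y Hy] := numeral_exists (F k).
have [q Hq] := opair_exists x y; have [t Ht] := adjoin_exists s q.
exists t => p; apply: (iff_trans (Ht p)); split.
  case=> [/Hs [i [x' [y' [ik ? ? ?]]]]|->]; last by exists k, x, y.
  by exists i, x', y'; split=> //; apply: ltnW.
move=> [i [x' [y' [ik Hx' Hy' Hp]]]].
move: ik; rewrite ltnS leq_eqVlt => /orP [/eqP e|ik].
  subst i; right; apply: opair_uniq Hp _.
  by rewrite (numeral_uniq Hx' Hx) (numeral_uniq Hy' Hy).
by left; apply/Hs; exists i, x', y'.
Qed.

(** The truth condition of [app_f]. *)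
Definition is_app s x y := exists p, is_opair x y p /\ mem_rel p s.

Lemma sequence_app F k s i x y : is_sequence F k s -> i < k ->
  is_numeral i x -> is_numeral (F i) y -> is_app s x y.
Proof.
move=> Hs ik Hx Hy; have [p Hp] := opair_exists x y.
by exists p; split=> //; apply/Hs; exists i, x, y.
Qed.

Lemma sequence_appE F k s x y : is_sequence F k s -> is_app s x y ->
  exists i, [/\ i < k, is_numeral i x & is_numeral (F i) y].
Proof.
move=> Hs [p [Hp /Hs [i [x' [y' [ik Hx Hy Hp']]]]]].
by have [e1 e2] := opair_inj Hp Hp'; subst; exists i.
Qed.

Lemma sequence_function F k s n (r : var n -> M) :
  is_sequence F k s -> sat (function_f v0) (scons s r).
Proof.
move=> Hs; split=> [p /Hs [i [x [y [_ _ _ Hp]]]]|x y y' [Hy Hy']].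
  by exists x, y.
have [i [_ Hi HFi]] := sequence_appE Hs Hy.
have [j [_ Hj HFj]] := sequence_appE Hs Hy'.
rewrite (numeral_inj Hj Hi) in HFj.
exact: numeral_uniq HFi HFj.
Qed.

(** * Primitive recursive computations in the model *)

(** The numerals of the true values witness every existential quantifier of
    [graph_f], and the finite sequence of true values witnesses the one over
    recursion computations.  Variables and environment are arbitrary so that
    the induction passes under these quantifiers. *)
Lemma sat_graph k (f : primrec k) n (x : var k -> var n) (y : var n)
    (r : var n -> M) (v : var k -> nat) :
  (forall i, is_numeral (v i) (r (x i))) ->
  is_numeral (eval f v) (r y) -> sat (graph_f f x y) r.
Proof.
elim: f n x y r v => {k} [k||k i|k m h IHh g IHg|k g IHg h IHh] n x y r v.
- by [].
- by move=> Hx; apply: succ_numeral.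
- by move=> Hx Hy; apply: numeral_uniq Hy (Hx i).
- move=> Hx Hy.
  have [d Hd] := var_choice (fun i => numeral_exists (eval (g i) v)).
  apply: (sat_exs (d := d)); split.
    apply: sat_bigand => i; apply: (IHg i _ _ _ _ v).
      by move=> j; rewrite catenv_oldv.
    by rewrite catenv_newv.
  apply: (IHh _ _ _ _ (fun i => eval (g i) v)).
    by move=> i; rewrite catenv_newv.
  by rewrite catenv_oldv.
set a := v vz; set v' := fun i => v (vs i) => Hx Hy.
(* The computation has a + 1 values, at the arguments 0, ..., a. *)
pose F i := eval (PRec g h) (scons i v').
have [s Hs] := finite_sequence_exists F a.+1.
have Ha : is_numeral a (r (x vz)) := Hx vz.
exists s; split; last split; last split; last split.
- exact: sequence_function Hs.
- move=> z; split.
    case=> y' /(sequence_appE Hs) [i [ia Hi _]].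
    move: ia; rewrite ltnS leq_eqVlt => /orP [/eqP e|ia].
      by right; rewrite e in Hi; apply: numeral_uniq Hi Ha.
    by left; apply/(mem_numeral Ha); exists i.
  move=> Hz.
  have [i ia Hi] : exists2 i, i < a.+1 & is_numeral i z.
    case: Hz => [/(mem_numeral Ha) [i ia Hi]|/= ->]; last by exists a.
    by exists i => //; apply: ltnW.
  have [y' Hy'] := numeral_exists (F i).
  by exists y'; apply: sequence_app Hs ia Hi Hy'.
- have [z Hz] := numeral_exists 0; have [y' Hy'] := numeral_exists (F 0).
  exists z, y'; split; first exact: Hz.
  split; last exact: sequence_app Hs _ Hz Hy'.
  by apply: (IHg _ _ _ _ v') => // i; apply: (Hx (vs i)).
- move=> z /(mem_numeral Ha) [i ia Hi].
  have [z' Hz'] := numeral_exists i.+1.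
  have [y' Hy'] := numeral_exists (F i).
  have [y'' Hy''] := numeral_exists (F i.+1).
  exists z', y', y''; split; first exact: succ_numeral Hi Hz'.
  split; first by apply: sequence_app Hs _ Hi Hy'; apply: ltnW.
  split; first exact: sequence_app Hs _ Hz' Hy''.
  apply: (IHh _ _ _ _ (scons i (scons (F i) v'))); last exact: Hy''.
  by case=> [[j|]|] //; apply: (Hx (vs j)).
- exact: sequence_app Hs _ Ha Hy.
Qed.

End Model.

Theorem proposition4p2 (P : primrec_pred 1) :
  true_in_N (Pi01 P) -> BH_struct (translate (Pi01 P)).
Proof.
move=> P_true M M_ZFC notP M_std; apply: notP => x /M_std [k].
move=> /sat_numeral Hx.
have [y Hy] := numeral_exists M_ZFC 1.
exists y; split; last first.
  exact: (proj2 (sat_numeral 1 v0 (scons y (scons x (env0 M))))).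
apply: (sat_graph M_ZFC (v := scons k (env0 nat))); first by case=> [[]|].
by have := P_true k; rewrite /= /holds => ->.
Qed.
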